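(* Let $X_1,X_2,\dots$ be independent identically distributed zero-mean sub-exponential real-valued random variables such that $0<\|X_1\|_{\psi_1}<\infty$. For each natural $n$, let $S_n:=X_1+\cdots+X_n$. Then $$\mathsf P(S_n\ge x)\le\exp\Big(-\frac{x^2}{(2+o(1))\,n\,\mathsf E X_1^2}\Big)$$ whenever the natural number $n$ and the real number $x$ vary simultaneously so that $0\le x/n\to0$ (it is not required that $n\to\infty$). Explicitly: for every real $\delta>0$ there is a real $\eta>0$ (depending on $\delta$ and the distribution of $X_1$) such that for all natural $n\ge1$ and all real $x$ with $0\le x/n\le\eta$ one has $$\mathsf P(S_n\ge x)\le\exp\Big(-\frac{x^2}{(2+\delta)\,n\,\mathsf E X_1^2}\Big).$$
   Context: For $u\in[0,\infty)$, let $\psi_1(u):=e^u-1$. For a real-valued random variable $X$, let $\|X\|_{\psi_1}:=\inf\{x>0\colon\mathsf E\psi_1(|X|/x)\le1\}$, with $\inf\emptyset:=\infty$. A random variable $X$ is called sub-exponential if $\|X\|_{\psi_1}<\infty$ (light tails). *)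

(* Defs.v *)
From HB Require Import structures.
From mathcomp Require Import all_boot all_order all_algebra finmap.
From mathcomp Require Import all_classical all_reals all_analysis.

Set Implicit Arguments.
Unset Strict Implicit.
Unset Printing Implicit Defensive.

Import Order.TTheory GRing.Theory Num.Theory.
Import numFieldNormedType.Exports.

Local Open Scope classical_set_scope.
Local Open Scope ring_scope.

Definition psi1 (R : realType) (u : R) : R := expR u - 1.

(* The expectation takes values in [\bar R] (the integrand is nonnegative, the
   value +oo is allowed), and [ereal_inf set0 = +oo]. *)
Definition psi1_norm (d : measure_display) (T : measurableType d)
    (R : realType) (P : probability T R) (X : {RV P >-> R}) : \bar R :=
  ereal_inf [set x%:E | x in
    [set x : R | 0 < x /\ ('E_P[fun w => psi1 (`|X w| / x)%R] <= 1)%E]].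

Definition sub_exponential (d : measure_display) (T : measurableType d)
    (R : realType) (P : probability T R) (X : {RV P >-> R}) : Prop :=
  (psi1_norm X < +oo)%E.

(* Mutual independence: the product rule over every finite subfamily. *)
Definition independent_RVs (d : measure_display) (T : measurableType d)
    (R : realType) (P : probability T R) (X : nat -> {RV P >-> R}) : Prop :=
  forall (J : {fset nat}) (A : nat -> set R),
    (forall i : nat, i \in J -> measurable (A i)) ->
    P (\bigcap_(i in [set` J]) (X i @^-1` A i)) =
      (\prod_(i <- J) P (X i @^-1` A i))%E.

Definition identically_distributed (d : measure_display)
    (T : measurableType d) (R : realType) (P : probability T R)
    (X : nat -> {RV P >-> R}) : Prop :=
  forall (i j : nat) (A : set R), measurable A ->
    distribution P (X i) A = distribution P (X j) A.

(* Sequences are indexed from 0: [X i] stands for X_{i+1}, so [X 0] is X_1 and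
   [partial_sum X n] is S_n = X_1 + ... + X_n. *)
Definition partial_sum (d : measure_display) (T : measurableType d)
    (R : realType) (P : probability T R) (X : nat -> {RV P >-> R}) (n : nat)
    (w : T) : R :=
  \sum_(i < n) X i w.

(* Main.v *)
Require Import Defs.
From HB Require Import structures.
From mathcomp Require Import all_boot all_order all_algebra finmap.
From mathcomp Require Import all_classical all_reals all_analysis.
From mathcomp Require Import measurable_realfun ring lra.

Set Implicit Arguments.
Unset Strict Implicit.
Unset Printing Implicit Defensive.

Import Order.TTheory GRing.Theory Num.Theory.
Import numFieldNormedType.Exports.

Local Open Scope classical_set_scope.
Local Open Scope ring_scope.

(** The proof is the exponential (Chernoff) method. For h > 0,
    P (S_n >= x) <= exp (- h x) E exp (h S_n), and by independence
    E exp (h S_n) is the n-th power of E exp (h X_1).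

    The tail condition gives k > 0 with E exp (|X_1| / k) <= 2. This is enough
    to control the third-order remainder of the Taylor expansion of exp (h X_1)
    in mean: as E X_1 = 0, for 2 k h <= 1,
      E exp (h X_1) <= 1 + h^2 s / 2 + 96 k^3 h^3
                    <= exp (h^2 s / 2 + 96 k^3 h^3),   s = E X_1^2
    ([mgf_le]). With v = x / n, the choice h = v / s, which minimizes
    h^2 s / 2 - h v, leaves the exponent
      n (- v^2 / (2 s) + 96 k^3 v^3 / s^3),
    and the cubic term is a small fraction of the quadratic one as soon as
    v is small compared with a quantity depending on k, s and delta only
    ([exponent_le]). Both k and s are read off from the law mu of X_1, so eta
    depends only on mu and delta.

    Factorization of E exp (h S_n) is obtained directly from the product rule
    on events ([expectation_prod_of_indep]): the indicators of the events
    {X_i in A_i} are replaced one at a time by nonnegative functions of X_i.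
    Each replacement is an instance of the principle that an identity
    E (g 1_A(Y)) = c P (Y in A), valid for all A, extends to
    E (g f(Y)) = c E f(Y) ([integral_mul_comp_of_indic]). *)

(** * Elementary bounds on the exponential *)

(** Termwise comparison of power series: for j >= 0 the term of order j + 3 of
    the series at u is at most |u|^3 times the term of order j of the series
    at |u|, because j! <= (j + 3)!. *)
Lemma expR_le_taylor2 (R : realType) (u : R) :
  expR u <= 1 + u + u ^+ 2 / 2 + `|u| ^+ 3 * expR `|u|.
Proof.
pose s := series (exp_coeff u); pose t := series (exp_coeff `|u|).
have partial n : s (n + 3)%N <= 1 + u + u ^+ 2 / 2 + `|u| ^+ 3 * t n.
  rewrite /s /t /series /= !big_mkord addnC big_split_ord /=.
  apply: lerD.
    rewrite !big_ord_recr big_ord0 /= /exp_coeff /= !fact0 !factS.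
    by rewrite expr0 expr1 add0r !divr1.
  rewrite mulr_sumr; apply: ler_sum => i _; rewrite /exp_coeff /=.
  apply: (le_trans (ler_norm _)); rewrite normrM normrX exprD -mulrA.
  apply: ler_wpM2l; first exact: exprn_ge0.
  apply: ler_wpM2l; first exact: exprn_ge0.
  rewrite ger0_norm ?invr_ge0// lef_pV2 ?posrE ?ltr0n ?fact_gt0// ler_nat.
  by rewrite leq_fact // leq_addl.
have cs : s (n + 3)%N @[n --> \oo] --> expR u.
  by rewrite cvg_shiftn; exact: is_cvg_series_exp_coeff.
have ct : 1 + u + u ^+ 2 / 2 + `|u| ^+ 3 * t n @[n --> \oo] -->
    1 + u + u ^+ 2 / 2 + `|u| ^+ 3 * expR `|u|.
  apply: cvgD; first exact: cvg_cst.
  apply: cvgMr; exact: is_cvg_series_exp_coeff.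
rewrite -(cvg_lim _ cs)// -(cvg_lim _ ct)//.
apply: ler_lim.
- by apply/cvg_ex; exists (expR u).
- by apply/cvg_ex; eexists; exact: ct.
- exact: nearW.
Qed.

Lemma expR_ge_cube (R : realType) (t : R) : 0 <= t -> t ^+ 3 <= 6 * expR t.
Proof.
move=> t0; have := @expR_ge1Dxn R t 2 t0; rewrite (_ : 3`!%:R = 6 :> R)//.
lra.
Qed.

Lemma expR_ge_sqr (R : realType) (t : R) : 0 <= t -> t ^+ 2 <= 2 * expR t.
Proof.
move=> t0; have := @expR_ge1Dxn R t 1 t0; rewrite (_ : 2`!%:R = 2 :> R)//.
lra.
Qed.

(** The remainder of the Taylor expansion, dominated by a function whose mean is
    controlled by the tail condition: half of the exponent |y| / k pays for
    the cube, through t^3 <= 6 exp t at t = |y| / (2 k), and the other half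
    for exp (h |y|), which is where 2 k h <= 1 is used. *)
Lemma cube_mul_expR_le (R : realType) (k h y : R) :
  0 < k -> 0 <= h -> 2 * k * h <= 1 ->
  `|h * y| ^+ 3 * expR `|h * y| <= 48 * k ^+ 3 * h ^+ 3 * expR (`|y| / k).
Proof.
move=> k0 h0 kh; pose t := `|y| / (2 * k).
have t0 : 0 <= t by rewrite divr_ge0 ?mulr_ge0// ltW.
have yE : `|y| = 2 * k * t by rewrite /t; field; rewrite gt_eqF.
rewrite normrM (ger0_norm h0) yE.
have -> : 2 * k * t / k = t + t by field; rewrite gt_eqF.
have tle : expR (h * (2 * k * t)) <= expR t.
  by rewrite ler_expR; have := ler_wpM2r t0 kh; lra.
rewrite expRD.
have -> : (h * (2 * k * t)) ^+ 3 = 8 * k ^+ 3 * h ^+ 3 * t ^+ 3 by ring.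
have -> : 48 * k ^+ 3 * h ^+ 3 * (expR t * expR t) =
   8 * k ^+ 3 * h ^+ 3 * (6 * expR t) * expR t by ring.
have k30 : 0 <= 8 * k ^+ 3 * h ^+ 3.
  by rewrite !mulr_ge0 ?exprn_ge0// ltW.
apply: ler_pM => //; first by rewrite mulr_ge0 ?exprn_ge0.
by rewrite ler_wpM2l// expR_ge_cube.
Qed.

(** * Independence and products of expectations *)

Section change_of_density.
Local Open Scope ereal_scope.
Context d (T : measurableType d) (R : realType) (P : probability T R).
Import HBNNSimple.

(** Canonical decomposition of a simple function of Y, integrated against the
    weight g. *)
Lemma integral_mul_nnsfun_comp (g : T -> R) (Y : {RV P >-> R})
    (s : {nnsfun R >-> R}) :
  measurable_fun setT g -> (forall w, (0 <= g w)%R) ->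
  \int[P]_w (g w * s (Y w))%:E =
  \sum_(r \in range s) r%:E * \int[P]_w (g w * \1_(s @^-1` [set r]) (Y w))%:E.
Proof.
move=> mg g0.
have mi r : measurable_fun setT (fun w => \1_(s @^-1` [set r]) (Y w) : R).
  exact: measurableT_comp.
under eq_integral do rewrite mulrC fimfunE EFinM -fsumEFin//.
transitivity (\int[P]_w \sum_(r \in range s)
    (g w)%:E * (r * \1_(s @^-1` [set r]) (Y w))%:E).
  apply: eq_integral => w _; rewrite muleC ge0_mule_fsumr// => r.
  by rewrite EFinM nnfun_muleindic_ge0.
rewrite ge0_integral_fsum//; last 2 first.
- move=> r; apply/measurable_EFinP; apply: measurable_funM => //.
  exact: measurable_funM.
- move=> r w _; rewrite mule_ge0 ?lee_fin//.
  by have := nnfun_muleindic_ge0 s r (Y w); rewrite -EFinM lee_fin.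
apply: eq_fsbigr => r /set_mem[y _ <-].
rewrite -ge0_integralZl//; last 3 first.
- by apply/measurable_EFinP; exact: measurable_funM.
- by move=> w _; rewrite lee_fin mulr_ge0.
- by rewrite lee_fin.
by apply: eq_integral => w _; rewrite -!EFinM mulrCA.
Qed.

(** The hypothesis says that the measure of density g, transported by Y, is c
    times the law of Y. The two measures then integrate every f >= 0 alike,
    which is seen on simple functions and extended by monotone convergence;
    c is finite so that multiplication by c commutes with the limit. *)
Lemma integral_mul_comp_of_indic (g : T -> R) (Y : {RV P >-> R}) (c : R) :
  measurable_fun setT g -> (forall w, (0 <= g w)%R) ->
  (forall A : set R, measurable A ->
    \int[P]_w (g w * \1_A (Y w))%:E = c%:E * \int[P]_w (\1_A (Y w))%:E) ->
  forall f : R -> R, measurable_fun setT f -> (forall y, (0 <= f y)%R) ->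
    \int[P]_w (g w * f (Y w))%:E = c%:E * \int[P]_w (f (Y w))%:E.
Proof.
move=> mg g0 gA f mf f0.
have mef : measurable_fun setT (EFin \o f) by exact/measurable_EFinP.
pose f_ := nnsfun_approx measurableT mef.
have cvf y : (f_ n y)%:E @[n --> \oo] --> (f y)%:E.
  by apply: (cvg_nnsfun_approx measurableT mef) => // z _; rewrite /= lee_fin.
have ndf y : nondecreasing_seq (fun n => (f_ n y)%:E).
  by move=> m n mn; rewrite lee_fin; exact/lefP/nd_nnsfun_approx.
have mfY n : measurable_fun setT (fun w => f_ n (Y w)).
  exact: measurableT_comp.
have simple n :
    \int[P]_w (g w * f_ n (Y w))%:E = c%:E * \int[P]_w (f_ n (Y w))%:E.
  transitivity (c%:E * \int[P]_w (1 * f_ n (Y w))%:E); last first.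
    by congr (_ * _); apply: eq_integral => w _; rewrite mul1r.
  rewrite !integral_mul_nnsfun_comp// ge0_mule_fsumr; last first.
    move=> r; have [r0|r0] := leP 0%R r.
      by rewrite mule_ge0 ?lee_fin// integral_ge0.
    rewrite integral0_eq ?mule0// => w _.
    by rewrite preimage_nnfun0// indic0 mulr0.
  apply: eq_fsbigr => r _; rewrite gA// muleCA; congr (_ * (_ * _)).
  by apply: eq_integral => w _; rewrite mul1r.
have cvg_weighted (h : T -> R) :
    measurable_fun setT h -> (forall w, (0 <= h w)%R) ->
    \int[P]_w (h w * f_ n (Y w))%:E @[n --> \oo] -->
    \int[P]_w (h w * f (Y w))%:E.
  move=> mh h0.
  have lim_h w : (h w * f_ n (Y w))%:E @[n --> \oo] --> (h w * f (Y w))%:E.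
    under eq_fun do rewrite EFinM.
    by rewrite EFinM; apply: cvgeZl.
  rewrite (_ : (fun w => (h w * f (Y w))%:E) =
      (fun w => limn (fun n => (h w * f_ n (Y w))%:E))); last first.
    by apply/funext => w; apply/esym/cvg_lim.
  apply: cvg_monotone_convergence => //.
  - by move=> n; apply/measurable_EFinP; exact: measurable_funM.
  - by move=> n w _; rewrite lee_fin mulr_ge0.
  - move=> w _ m n mn; rewrite lee_fin ler_wpM2l//.
    by have := ndf (Y w) m n mn; rewrite lee_fin.
have := cvg_weighted _ mg g0; under eq_fun do rewrite simple.
move/cvg_lim => <-//; apply/cvg_lim => //; apply: cvgeZl => //.
have := cvg_weighted (cst 1%R) (measurable_cst _) (fun=> ler01).
under eq_fun do under eq_integral do rewrite /= mul1r.
by under [X in _ --> X -> _]eq_integral do rewrite /= mul1r.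
Qed.

End change_of_density.

Section independence.
Local Open Scope ereal_scope.
Context d (T : measurableType d) (R : realType) (P : probability T R).

Lemma expectation_prod_indic (X : nat -> {RV P >-> R}) (A : nat -> set R)
    (n : nat) :
  independent_RVs X -> (forall i, measurable (A i)) ->
  \int[P]_w (\prod_(i < n) \1_(A i) (X i w))%:E =
  \prod_(i < n) \int[P]_w (\1_(A i) (X i w))%:E.
Proof.
move=> indX mA.
pose J : {fset nat} := [fset i in iota 0 n]%fset.
have inJ i : (i \in J) = (i < n)%N by rewrite !inE mem_iota.
have mpre i : measurable (X i @^-1` A i).
  by rewrite -[X in measurable X]setTI; exact: measurable_funP.
have intE i : \int[P]_w (\1_(A i) (X i w))%:E = P (X i @^-1` A i).
  by rewrite -[X in P X]setIT -integral_indic.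
under [RHS]eq_bigr do rewrite intE.
transitivity (P (\bigcap_(i in [set` J]) (X i @^-1` A i))).
  rewrite -[X in P X]setIT -integral_indic//; last exact: fin_bigcap_measurable.
  apply: eq_integral => w _; congr (_%:E); rewrite indicE.
  under eq_bigr do rewrite indicE.
  have [wJ|wJ] := boolP (w \in _).
    rewrite big1// => i _; rewrite mem_set//.
    by move/set_mem : wJ; apply => /=; rewrite inJ.
  have [i iw] : exists i : 'I_n, X i w \notin A i.
    apply: contrapT => /forallNP Aw; move/negP : wJ; apply.
    apply/mem_set => i /=; rewrite inJ => ni.
    by have /negP := Aw (Ordinal ni); rewrite negbK => /set_mem.
  by rewrite (bigD1 i)//= (negbTE iw) mul0r.
rewrite indX// big_imfset//= (undup_id (iota_uniq 0 n)) -[X in iota 0 X]subn0.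
by rewrite -[LHS]/(\prod_(0 <= i < n) _) big_mkord.
Qed.

(** Independence speaks of indicators only. The product rule is extended to
    functions by induction on the number k of leading factors that are not
    indicators: with the other factors fixed, the rule for k factors supplies
    the identity required by [integral_mul_comp_of_indic] to replace the
    indicator in position k by an arbitrary nonnegative function. *)
Lemma expectation_prod_of_indep (X : nat -> {RV P >-> R}) (n : nat)
    (f : nat -> R -> R) :
  independent_RVs X ->
  (forall i, measurable_fun setT (f i)) -> (forall i y, (0 <= f i y)%R) ->
  (forall i, \int[P]_w (f i (X i w))%:E < +oo) ->
  \int[P]_w (\prod_(i < n) f i (X i w))%:E =
  \prod_(i < n) \int[P]_w (f i (X i w))%:E.
Proof.
move=> indX.
(* The first k factors are arbitrary, the other ones are indicators. *)
suff replaced k : forall f : nat -> R -> R,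
    (forall i, (k <= i < n)%N -> exists2 A, measurable A & f i = \1_A) ->
    (forall i, measurable_fun setT (f i)) -> (forall i y, (0 <= f i y)%R) ->
    (forall i, \int[P]_w (f i (X i w))%:E < +oo) ->
    \int[P]_w (\prod_(i < n) f i (X i w))%:E =
    \prod_(i < n) \int[P]_w (f i (X i w))%:E.
  by apply: (replaced n) => i; rewrite ltnNge andbN.
elim: k {f} => [|k IH] f.
  move=> find _ _ _.
  have /choice[A HA] : forall i, exists A,
      measurable A /\ ((i < n)%N -> f i = \1_A).
    move=> i; have [/find[A mA fA]|ni] := ltnP i n; first by exists A.
    by exists setT; split => //; rewrite ltnNge ni.
  transitivity (\int[P]_w (\prod_(i < n) \1_(A i) (X i w))%:E).
    apply: eq_integral => w _; congr (_%:E); apply: eq_bigr => i _.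
    by rewrite (HA i).2.
  rewrite expectation_prod_indic//; last by move=> i; exact: (HA i).1.
  by apply: eq_bigr => i _; rewrite (HA i).2.
move=> find mf f0 ffin.
have [nk|kn] := leqP n k.
  by apply: IH => // i /andP[ki /leq_trans/(_ nk)]; rewrite ltnNge ki.
have [c c0 cE] : exists2 c, (0 <= c)%R &
   \prod_(i < n | (i != k :> nat)) \int[P]_w (f i (X i w))%:E = c%:E.
  exists (\prod_(i < n | (i != k :> nat)) fine (\int[P]_w (f i (X i w))%:E))%R.
    apply: prodr_ge0 => i _; rewrite fine_ge0// integral_ge0// => w _.
    by rewrite lee_fin.
  rewrite -prodEFin; apply: eq_bigr => i _; rewrite fineK// ge0_fin_numE//.
  by rewrite integral_ge0// => w _; rewrite lee_fin.
pose g w := (\prod_(i < n | (i != k :> nat)) f i (X i w))%R.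
have mfX i : measurable_fun setT (fun w => f i (X i w)).
  exact: measurableT_comp.
have mg : measurable_fun setT g.
  by rewrite /g; under eq_fun do rewrite -big_filter; exact: measurable_prod.
have g0 w : (0 <= g w)%R by exact: prodr_ge0.
rewrite (bigD1 (Ordinal kn))//= muleC cE.
rewrite -(@integral_mul_comp_of_indic _ _ _ _ g)//.
  apply: eq_integral => w _; congr (_%:E).
  by rewrite (bigD1 (Ordinal kn))//= mulrC.
move=> A mA.
pose f' i : R -> R := if i == k then \1_A else f i.
have f'k : f' k = \1_A by rewrite /f' eqxx.
have f'E i : i != k -> f' i = f i by rewrite /f' => /negbTE ->.
have : \int[P]_w (\prod_(i < n) f' i (X i w))%:E =
    \prod_(i < n) \int[P]_w (f' i (X i w))%:E.
  apply: IH.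
  - move=> i /andP[]; rewrite leq_eqVlt => /predU1P[<- _|ki ni].
      by exists A.
    by rewrite f'E ?gtn_eqF//; apply: find; rewrite ki.
  - by move=> i; rewrite /f'; case: ifP.
  - by move=> i y; rewrite /f'; case: ifP.
  - move=> i; rewrite /f'; case: ifP => // _.
    apply: (@le_lt_trans _ _ (\int[P]_w (cst 1 w))).
      apply: ge0_le_integral => //.
      - by apply/measurable_EFinP; exact: measurableT_comp.
      - by move=> w _; rewrite lee_fin indicE; case: (_ \in _).
    rewrite integral_cst// mul1e /= (@probability_setT _ _ _ P).
    by rewrite ltry.
rewrite (bigD1 (Ordinal kn))//= f'k muleC.
under [X in _ = X * _]eq_bigr => i ik do rewrite f'E//.
rewrite cE => <-; apply: eq_integral => w _; congr (_%:E).
rewrite (bigD1 (Ordinal kn))//= f'k mulrC; congr (_ * _)%R.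
by apply: eq_bigr => i ik; rewrite f'E.
Qed.

End independence.

(** * The moment generating function under a sub-exponential tail *)

Section moment_generating_function.
Context d (T : measurableType d) (R : realType) (P : probability T R)
  (X : {RV P >-> R}).

Lemma Lfun1_of_expR_le (k a : R) (f : R -> R) :
  measurable_fun setT f -> (forall y, `|f y| <= a * expR (`|y| / k)) ->
  (\int[P]_w (expR (`|X w| / k))%:E < +oo)%E ->
  (fun w => f (X w)) \in Lfun P 1.
Proof.
move=> mf fa expfin; apply/Lfun1_integrable.
have mG : measurable_fun setT (fun w => expR (`|X w| / k)).
  apply: measurableT_comp => //; apply: measurable_funM => //.
  exact: measurableT_comp.
have iG : P.-integrable setT (EFin \o (fun w => expR (`|X w| / k))).
  apply/integrableP; split; first exact/measurable_EFinP.
  by under eq_integral do rewrite /= ger0_norm ?expR_ge0//.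
apply: (le_integrable _ _ _ (integrableZl measurableT a iG)) => //.
  by apply/measurable_EFinP; exact: measurableT_comp.
move=> w _ /=; rewrite lee_fin (le_trans (fa (X w)))//.
exact: ler_norm.
Qed.

(** The mean of the second-order Taylor bound. The linear term vanishes because
    X is centered, and the constant 96 is the 48 of [cube_mul_expR_le] times
    the bound 2 on E exp (|X| / k). *)
Lemma mgf_le (k h : R) : 0 < k -> 0 <= h -> 2 * k * h <= 1 ->
  (\int[P]_w (expR (`|X w| / k))%:E <= 2%:E)%E ->
  ('E_P[X] = 0)%E ->
  (\int[P]_w (expR (h * X w))%:E <=
    (expR (h ^+ 2 / 2 * fine 'E_P[fun w => (X w ^+ 2)%R] +
           96 * k ^+ 3 * h ^+ 3))%:E)%E.
Proof.
move=> k0 h0 kh exp2 EX0.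
have exp_fin : (\int[P]_w (expR (`|X w| / k))%:E < +oo)%E.
  by apply: le_lt_trans exp2 _; rewrite ltry.
pose G w := expR (`|X w| / k).
have yk0 (y : R) : 0 <= `|y| / k by rewrite divr_ge0// ltW.
have LX : (X : T -> R) \in Lfun P 1.
  apply: (@Lfun1_of_expR_le k k id) => // y.
  have := expR_ge1Dx (`|y| / k) => yE.
  by rewrite mulrC -ler_pdivrMr//; apply: le_trans yE; rewrite lerDr.
have LX2 : (fun w => X w ^+ 2) \in Lfun P 1.
  apply: (@Lfun1_of_expR_le k (2 * k ^+ 2) (fun y => y ^+ 2)) => // [y].
  rewrite ger0_norm ?sqr_ge0//.
  have := expR_ge_sqr (yk0 y); rewrite expr_div_n real_normK ?num_real//.
  by rewrite ler_pdivrMr ?exprn_gt0// mulrAC.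
have LG : G \in Lfun P 1.
  apply: (@Lfun1_of_expR_le k 1 (fun y => expR (`|y| / k))) => // [|y].
    by apply: measurableT_comp => //; apply: measurable_funM.
  by rewrite mul1r ger0_norm// expR_ge0.
(* The pointwise majorant of exp (h X). *)
pose M w := 1 + h * X w + h ^+ 2 / 2 * X w ^+ 2 + 48 * k ^+ 3 * h ^+ 3 * G w.
have le_expM w : expR (h * X w) <= M w.
  apply: le_trans (expR_le_taylor2 _) _; apply: lerD.
    by rewrite exprMn; lra.
  exact: cube_mul_expR_le.
have EM : ('E_P[M] = 1 + h%:E * 'E_P[X] +
    (h ^+ 2 / 2)%:E * 'E_P[fun w => (X w ^+ 2)%R] +
    (48 * k ^+ 3 * h ^+ 3)%:E * 'E_P[G])%E.
  have L1 := Lfun_cst P 1 (1 : R).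
  have LhX : h \o* X \in Lfun P 1 by rewrite Lfun_scale.
  have LhX2 : (h ^+ 2 / 2) \o* (fun w => X w ^+ 2) \in Lfun P 1.
    by rewrite Lfun_scale.
  have LhG : (48 * k ^+ 3 * h ^+ 3) \o* G \in Lfun P 1 by rewrite Lfun_scale.
  rewrite -(expectation_cst P 1) -!expectationZl// -!expectationD ?rpredD//.
  by congr expectation; apply/funext => w; rewrite /M /=; ring.
have mX : measurable_fun setT X by [].
apply: (@le_trans _ _ 'E_P[M]%E).
  rewrite unlock; apply: ge0_le_integral => //.
  - apply/measurable_EFinP; apply: measurableT_comp => //.
    exact: measurable_funM.
  - apply/measurable_EFinP; rewrite /M /G.
    apply: measurable_funD; first apply: measurable_funD.
    + by apply: measurable_funD => //; exact: measurable_funM.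
    + by apply: measurable_funM => //; exact: measurable_funX.
    + apply: measurable_funM => //; apply: measurableT_comp => //.
      by apply: measurable_funM => //; exact: measurableT_comp.
  - by move=> w _; rewrite lee_fin.
rewrite EM EX0 mule0 adde0.
have X2fin : 'E_P[fun w => (X w ^+ 2)%R]%E \is a fin_num.
  exact: expectation_fin_num.
rewrite -(fineK X2fin).
have Gfin : 'E_P[G]%E \is a fin_num by exact: expectation_fin_num.
have G2 : fine 'E_P[G]%E <= 2 by rewrite -lee_fin fineK// unlock.
rewrite -(fineK Gfin) -!EFinM -!EFinD lee_fin.
apply: le_trans (expR_ge1Dx _); rewrite -addrA lerD2l lerD2l.
have c0 : 0 <= 48 * k ^+ 3 * h ^+ 3 by rewrite !mulr_ge0 ?exprn_ge0// ltW.
by have := ler_wpM2l c0 G2; lra.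
Qed.

End moment_generating_function.

(** * The Chernoff bound *)

Section tail_bound.
Context d (T : measurableType d) (R : realType) (P : probability T R).

Lemma ge0_expectation_law (mu : probability R R) (Y : {RV P >-> R})
    (f : R -> R) :
  (forall A : set R, measurable A -> distribution P Y A = mu A) ->
  measurable_fun setT f -> (forall y, 0 <= f y) ->
  (\int[P]_w (f (Y w))%:E = \int[mu]_y (f y)%:E)%E.
Proof.
move=> lawY mf f0.
rewrite -[LHS](@ge0_integral_distribution _ _ _ _ _ P Y (EFin \o f))//.
  by apply: eq_measure_integral => A mA _; exact: lawY.
exact/measurable_EFinP.
Qed.

(** The infimum defining the psi1-norm need not be attained, but finiteness
    already exhibits an admissible k; E psi1 (|X| / k) <= 1 then reads
    E exp (|X| / k) <= 2. *)
Lemma sub_exponential_expR_le2 (X : {RV P >-> R}) :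
  sub_exponential X ->
  exists2 k : R, 0 < k & (\int[P]_w (expR (`|X w| / k))%:E <= 2%:E)%E.
Proof.
move=> /ereal_inf_lt[_ [k [k0 Ek] <-] _]; exists k => //.
have mG : measurable_fun setT (fun w => expR (`|X w| / k)).
  apply: measurableT_comp => //; apply: measurable_funM => //.
  exact: measurableT_comp.
have psi0 w : 0 <= psi1 (`|X w| / k).
  by rewrite /psi1 subr_ge0 -expR0 ler_expR divr_ge0// ltW.
rewrite (_ : (fun w => (expR (`|X w| / k))%:E) =
    (fun w => (psi1 (`|X w| / k))%:E + cst 1 w)%E); last first.
  by apply/funext => w; rewrite -EFinD /psi1 subrK.
rewrite ge0_integralD//; last 2 first.
- by move=> w _; rewrite lee_fin.
- by apply/measurable_EFinP; exact: measurable_funB.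
rewrite integral_cst// mul1e /= (@probability_setT _ _ _ P).
rewrite (_ : 2%:E = 1 + 1)%E; last by rewrite -EFinD.
by apply: leeD => //; move: Ek; rewrite unlock.
Qed.

Lemma chernoff_partial_sum (X : nat -> {RV P >-> R}) (n : nat) (x h m : R) :
  independent_RVs X -> 0 < h ->
  (forall i, (\int[P]_w (expR (h * X i w))%:E <= (expR m)%:E)%E) ->
  (P [set w | (x <= partial_sum X n w)%R] <= (expR (n%:R * m - h * x))%:E)%E.
Proof.
move=> indX h0 mgf.
pose S : {RV P >-> R} := (\sum_(i < n) X i)%R.
have SE w : S w = partial_sum X n w by rewrite /S mfun_sum.
rewrite (_ : [set _ | _] = [set w | x <= S w]); last first.
  by apply/seteqP; split => w /=; rewrite SE.
apply: le_trans (chernoff S x h0) _.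
rewrite expRD EFinM; apply: lee_wpmul2r; first by rewrite lee_fin expR_ge0.
have -> : ('M_P S h)%E = (\int[P]_w (\prod_(i < n) expR (h * X i w))%:E)%E.
  rewrite /mmt_gen_fun unlock; apply: eq_integral => w _ /=.
  by rewrite SE /partial_sum mulrC mulr_sumr expR_sum.
have mexp : measurable_fun setT (fun y : R => expR (h * y)).
  by apply: measurableT_comp => //; exact: measurable_funM.
rewrite (@expectation_prod_of_indep _ _ _ _ X n
  (fun=> fun y => expR (h * y)))//; last first.
  by move=> i; apply: le_lt_trans (mgf i) _; rewrite ltry.
rewrite expRM_natl.
have -> : (expR m ^+ n)%:E = (\prod_(i < n) (expR m)%:E)%E.
  by rewrite prodEFin prodr_const card_ord.
pose rel (a b : \bar R) := (0 <= a <= b)%E.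
suff /andP[] : rel (\prod_(i < n) \int[P]_w (expR (h * X i w))%:E)%E
    (\prod_(i < n) (expR m)%:E)%E by [].
apply: (big_ind2 rel); rewrite /rel.
- by rewrite lexx lee01.
- move=> a b a' b' /andP[a0 ab] /andP[a'0 ab'].
  by rewrite mule_ge0//= lee_pmul.
- by move=> i _; rewrite mgf andbT integral_ge0// => w _; exact: expR_ge0.
Qed.

End tail_bound.

(** The exponent at h = v / s. The right-hand side minus the left-hand side is
    N v^2 / (2 (2 + delta) s^3) times
    delta s^2 - 192 k^3 (2 + delta) v, so the condition on v is the sharp one
    for this inequality when v > 0. *)
Lemma exponent_le (R : realType) (k s delta N v : R) :
  0 < k -> 0 < s -> 0 < delta -> 0 < N -> 0 <= v ->
  v <= delta * s ^+ 2 / (192 * k ^+ 3 * (2 + delta)) ->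
  N * ((v / s) ^+ 2 / 2 * s + 96 * k ^+ 3 * (v / s) ^+ 3) - v / s * (N * v) <=
  - ((N * v) ^+ 2 / ((2 + delta) * N * s)).
Proof.
move=> k0 s0 d0 N0 v0 vle.
have d2 : 0 < 2 + delta by lra.
have k3 : 0 < 192 * k ^+ 3 * (2 + delta) by rewrite !mulr_gt0// exprn_gt0.
move: vle; rewrite ler_pdivlMr// => vle.
rewrite -subr_ge0.
have -> : - ((N * v) ^+ 2 / ((2 + delta) * N * s)) -
  (N * ((v / s) ^+ 2 / 2 * s + 96 * k ^+ 3 * (v / s) ^+ 3) - v / s * (N * v)) =
  N * v ^+ 2 / (2 * (2 + delta) * s ^+ 3) *
  (delta * s ^+ 2 - v * (192 * k ^+ 3 * (2 + delta))).
  by field; rewrite !gt_eqF.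
rewrite mulr_ge0 ?subr_ge0// divr_ge0 ?mulr_ge0 ?exprn_ge0 ?sqr_ge0//;
  exact: ltW.
Qed.

Unset Implicit Arguments.

Theorem corollary1 (R : realType) (mu : probability R R)
    (delta : R) (delta_gt0 : 0 < delta) :
  exists2 eta : R, 0 < eta &
    forall (d : measure_display) (T : measurableType d) (P : probability T R)
      (X : nat -> {RV P >-> R}),
      independent_RVs X ->
      identically_distributed X ->
      (forall A : set R, measurable A -> distribution P (X 0%N) A = mu A) ->
      (forall i : nat, ('E_P[X i] = 0)%E) ->
      (forall i : nat, sub_exponential (X i)) ->
      (0 < psi1_norm (X 0%N) < +oo)%E ->
      forall (n : nat) (x : R),
        (1 <= n)%N ->
        0 <= x / n%:R <= eta ->
        (P [set w | (x <= partial_sum X n w)%R] <=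
          (expR (- (x ^+ 2 /
             ((2 + delta) * n%:R *
              fine 'E_P[fun w => (X 0%N w ^+ 2)%R]))))%:E)%E.
Proof.
have mexp (k : R) : measurable_fun setT (fun y : R => expR (`|y| / k)).
  apply: measurableT_comp => //; apply: measurable_funM => //.
have [[k k0 expk]|nok] := pselect (exists2 k : R, 0 < k &
    (\int[mu]_y (expR (`|y| / k))%:E <= 2%:E)%E); last first.
  (* No X of law mu is sub-exponential, so any eta will do. *)
  exists 1 => // d T P X _ _ law _ subX _ n x _ _; exfalso; apply: nok.
  have [k k0 expk] := sub_exponential_expR_le2 (subX 0%N).
  exists k => //.
  by rewrite -(ge0_expectation_law law)// => y; exact: expR_ge0.
pose s := fine (\int[mu]_y (y ^+ 2)%:E)%E.
have sE d (T : measurableType d) (P : probability T R) (Y : {RV P >-> R}) :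
    (forall A : set R, measurable A -> distribution P Y A = mu A) ->
    fine 'E_P[fun w => (Y w ^+ 2)%R]%E = s.
  move=> law; rewrite /s unlock.
  rewrite -(ge0_expectation_law (f := fun y => y ^+ 2) law)// => y.
  exact: sqr_ge0.
have trivial_bound d (T : measurableType d) (P : probability T R) (A : set T) :
    measurable A -> (P A <= (expR (- 0))%:E)%E.
  by move=> mA; rewrite oppr0 expR0 probability_le1.
have mS d (T : measurableType d) (P : probability T R)
    (X : nat -> {RV P >-> R}) n x :
    measurable [set w | x <= partial_sum X n w].
  have mf : measurable_fun setT (partial_sum X n) by exact: measurable_sum.
  rewrite (_ : [set _ | _] = partial_sum X n @^-1` `[x, +oo[); last first.
    by apply/seteqP; split => w /=; rewrite in_itv/= andbT.
  by rewrite -[X in measurable X]setTI; exact: mf.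
have s_ge0 : 0 <= s.
  by rewrite fine_ge0// integral_ge0// => y _; rewrite lee_fin sqr_ge0.
(* If s = 0 the division by s gives 0, and the right-hand side is 1. *)
have [s0|s0] := eqVneq s 0.
  exists 1 => // d T P X _ _ law _ _ _ n x _ _.
  by rewrite sE// s0 mulr0 invr0 mulr0; exact: trivial_bound.
have s_gt0 : 0 < s by rewrite lt_neqAle eq_sym s0.
(* The first bound ensures 2 k h <= 1 for h = v / s, the second one is the
   condition of exponent_le. *)
exists (Num.min (s / (2 * k)) (delta * s ^+ 2 / (192 * k ^+ 3 * (2 + delta)))).
  rewrite lt_min !divr_gt0 ?mulr_gt0 ?exprn_gt0//; lra.
move=> d T P X indX idX law EX0 _ _ n x n1.
rewrite sE// le_min => /and3P[].
set v := x / n%:R => v0 vk vdelta.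
have n0 : 0 < n%:R :> R by rewrite ltr0n.
have xE : x = n%:R * v by rewrite /v mulrC divfK// gt_eqF.
(* For x = 0 the choice h = v / s is not positive, but the bound is then 1. *)
move: v0; rewrite le_eqVlt => /predU1P[v0|v0].
  by rewrite xE -v0 mulr0 expr0n mul0r; exact: trivial_bound.
have lawi i : forall A : set R, measurable A -> distribution P (X i) A = mu A.
  by move=> A mA; rewrite (idX i 0%N)// law.
have h0 : 0 < v / s by rewrite divr_gt0.
apply: le_trans (chernoff_partial_sum n x
  (m := (v / s) ^+ 2 / 2 * s + 96 * k ^+ 3 * (v / s) ^+ 3) indX h0 _) _.
  move=> i; have := mgf_le (X := X i) k0 (ltW h0) _ _ (EX0 i).
  rewrite (sE _ _ _ _ (lawi i)); apply.
    by rewrite mulrA ler_pdivrMr// mul1r mulrC -ler_pdivlMr// mulr_gt0.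
  rewrite (ge0_expectation_law (lawi i) (mexp k))// => y; exact: expR_ge0.
by rewrite lee_fin ler_expR xE; apply: exponent_le => //; exact: ltW.
Qed.
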